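(* Consider the or-constrained program (MPOC) and the complementarity-constrained program $$\text{(CC-MPOC)}\qquad \min_{x,y,z} f(x)\ \text{ s.t. }\ g_i(x)\le 0\ (i\in\mathcal M),\ h_j(x)=0\ (j\in\mathcal P),\ G_l(x)-y_l\le 0,\ H_l(x)-z_l\le0,\ y_l\ge0,\ z_l\ge0,\ y_lz_l=0\ (l\in\mathcal Q).$$ 1. Let $\bar x\in X$ be a locally (respectively globally) optimal solution of (MPOC), and let $\bar y,\bar z\in\mathbb R^q$ be the vectors associated with $\bar x$ which are defined by $$\bar y_l:=\begin{cases}0 & l\in I^{-0}(\bar x)\cup I^{-+}(\bar x)\cup I^{0+}(\bar x)\cup I^{--}(\bar x)\cup I^{00}(\bar x),\\ 1& l\in I^{0-}(\bar x),\\ 2G_l(\bar x)& l\in I^{+-}(\bar x)\cup I^{+0}(\bar x),\end{cases}$$ $$\bar z_l:=\begin{cases}0 & l\in I^{0-}(\bar x)\cup I^{+-}(\bar x)\cup I^{+0}(\bar x)\cup I^{--}(\bar x)\cup I^{00}(\bar x),\\ 1& l\in I^{-0}(\bar x),\\ 2H_l(\bar x)& l\in I^{-+}(\bar x)\cup I^{0+}(\bar x)\end{cases}$$ for all $l\in\mathcal Q$. Then $(\bar x,\bar y,\bar z)$ is a locally (respectively globally) optimal solution of (CC-MPOC). 2. Let $(\tilde x,\tilde y,\tilde z)\in\mathbb R^n\times\mathbb R^q\times\mathbb R^q$ be a globally optimal solution of (CC-MPOC). Then $\tilde x$ is a globally optimal solution of (MPOC).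
   Context: Let $n,m,p,q$ be positive integers, $\mathcal M:=\{1,\dots,m\}$, $\mathcal P:=\{1,\dots,p\}$, $\mathcal Q:=\{1,\dots,q\}$, and let $f,g_i,h_j,G_l,H_l\colon\mathbb R^n\to\mathbb R$ be continuously differentiable for all $i\in\mathcal M$, $j\in\mathcal P$, $l\in\mathcal Q$. The program (MPOC) is: minimize $f(x)$ subject to $g_i(x)\le 0$ ($i\in\mathcal M$), $h_j(x)=0$ ($j\in\mathcal P$), and ($G_l(x)\le 0$ or $H_l(x)\le 0$) for all $l\in\mathcal Q$. Its feasible set is $X$. For $\bar x\in X$, the index sets $I^{st}(\bar x)\subset\mathcal Q$ with $s,t\in\{-,0,+\}$ (excluding $s=t=+$, which cannot occur) consist of those $l\in\mathcal Q$ for which $G_l(\bar x)$ has sign $s$ and $H_l(\bar x)$ has sign $t$; e.g. $I^{-0}(\bar x)=\{l: G_l(\bar x)<0,\ H_l(\bar x)=0\}$, $I^{+-}(\bar x)=\{l: G_l(\bar x)>0,\ H_l(\bar x)<0\}$, $I^{00}(\bar x)=\{l: G_l(\bar x)=H_l(\bar x)=0\}$. These eight sets partition $\mathcal Q$. *)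

(* Defs.v *)
From HB Require Import structures.
From mathcomp Require Import all_boot all_order all_algebra.
From mathcomp Require Import all_classical all_reals all_analysis.

Set Implicit Arguments.
Unset Strict Implicit.
Unset Printing Implicit Defensive.

Import Order.TTheory GRing.Theory Num.Theory.
Import numFieldNormedType.Exports.

Local Open Scope classical_set_scope.
Local Open Scope ring_scope.

(* On a finite-dimensional space, continuity of the differential (in operator
   norm) amounts to continuity of each of its values. *)
Definition continuously_differentiable (R : realType) (n : nat)
    (f : 'rV[R]_n -> R) : Prop :=
  (forall x, differentiable f x) /\
  (forall v : 'rV[R]_n, continuous (fun x : 'rV[R]_n => 'd f x v)).

Definition global_minimizer (R : realType) (T : Type)
    (f : T -> R) (X : set T) (x0 : T) : Prop :=
  X x0 /\ forall x, X x -> f x0 <= f x.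

Definition local_minimizer (R : realType) (T : topologicalType)
    (f : T -> R) (X : set T) (x0 : T) : Prop :=
  X x0 /\ \forall x \near x0, X x -> f x0 <= f x.

Section Programs.
Variables (R : realType) (n m p q : nat).
Variables (g : 'I_m -> 'rV[R]_n -> R) (h : 'I_p -> 'rV[R]_n -> R).
Variables (G H : 'I_q -> 'rV[R]_n -> R).

Definition mpoc_feasible : set 'rV[R]_n :=
  [set x | [/\ forall i, g i x <= 0,
               forall j, h j x = 0 &
               forall l, G l x <= 0 \/ H l x <= 0]].

Definition cc_mpoc_feasible : set ('rV[R]_n * 'rV[R]_q * 'rV[R]_q) :=
  [set w : 'rV[R]_n * 'rV[R]_q * 'rV[R]_q |
    let: (x, y, z) := w in
    [/\ forall i, g i x <= 0,
        forall j, h j x = 0 &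
        forall l, [/\ G l x - y 0 l <= 0,
                      H l x - z 0 l <= 0,
                      0 <= y 0 l,
                      0 <= z 0 l &
                      y 0 l * z 0 l = 0]]].

Definition cc_mpoc_objective (f : 'rV[R]_n -> R)
    (w : 'rV[R]_n * 'rV[R]_q * 'rV[R]_q) : R := f w.1.1.

End Programs.

Variant sign := Neg | Zero | Pos.

Definition has_sign (R : realType) (s : sign) (a : R) : bool :=
  match s with
  | Neg => a < 0
  | Zero => a == 0
  | Pos => 0 < a
  end.

Section Associated.
Variables (R : realType) (n q : nat) (G H : 'I_q -> 'rV[R]_n -> R).

Definition index_set (s t : sign) (x : 'rV[R]_n) : {set 'I_q} :=
  [set l | has_sign s (G l x) && has_sign t (H l x)]%SET.

Local Notation I := index_set.

(* At a feasible x the last branch of [ybar] is reached exactly for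
   l in I^{+-} or I^{+0}, and that of [zbar] exactly for l in I^{-+} or I^{0+},
   since I^{++} is then empty. *)
Definition ybar (x : 'rV[R]_n) : 'rV[R]_q :=
  \row_l
    if l \in (I Neg Zero x :|: I Neg Pos x :|: I Zero Pos x
              :|: I Neg Neg x :|: I Zero Zero x)%SET then 0
    else if l \in I Zero Neg x then 1
    else 2 * G l x.

Definition zbar (x : 'rV[R]_n) : 'rV[R]_q :=
  \row_l
    if l \in (I Zero Neg x :|: I Pos Neg x :|: I Pos Zero x
              :|: I Neg Neg x :|: I Zero Zero x)%SET then 0
    else if l \in I Neg Zero x then 1
    else 2 * H l x.

End Associated.

(* Main.v *)
Require Import Defs.
From HB Require Import structures.
From mathcomp Require Import all_boot all_order all_algebra.
From mathcomp Require Import all_classical all_reals all_analysis.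
From mathcomp Require Import lra.

(** (CC-MPOC) is a lifting of (MPOC): its objective depends on [x] only, and
    the projection [(x, y, z) |-> x] maps its feasible set onto that of (MPOC).
    Into: [y_l * z_l = 0] forces one of [G_l x <= y_l], [H_l x <= z_l] to read
    [_ <= 0] ([cc_mpoc_feasible_proj]).  Onto: at a feasible [x] one of
    [G_l x], [H_l x] is nonpositive, so its upper bound can be set to [0] while
    the other bound is raised as far as required; [ybar] and [zbar] are such a
    choice ([cc_mpoc_feasible_lift]).  Minimality of [xbar] then transfers upwards
    because the projection is continuous: it pulls a neighbourhood of [xbar]
    back to a neighbourhood of [(xbar, ybar, zbar)].  Global minimality
    transfers downwards because every competitor [x] can be lifted.  A local
    minimizer need not descend: the lifts of the points near [xt] may lie
    far from [(xt, yt, zt)]. *)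

Set Implicit Arguments.
Unset Strict Implicit.
Unset Printing Implicit Defensive.

Import Order.TTheory GRing.Theory Num.Theory.
Import numFieldNormedType.Exports.

Local Open Scope classical_set_scope.
Local Open Scope ring_scope.

Lemma cc_mpoc_feasible_proj (R : realType) (n m p q : nat)
    (g : 'I_m -> 'rV[R]_n -> R) (h : 'I_p -> 'rV[R]_n -> R)
    (G H : 'I_q -> 'rV[R]_n -> R) w :
  cc_mpoc_feasible g h G H w -> mpoc_feasible g h G H w.1.1.
Proof.
case: w => [[x y] z] [gx hx GHyz]; split=> //= l.
have [Gy Hz _ _ /eqP] := GHyz l.
by rewrite mulf_eq0 => /orP[] /eqP e; [left; move: Gy | right; move: Hz];
  rewrite e subr0.
Qed.

Lemma associated_constraints (R : realType) (n q : nat)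
    (G H : 'I_q -> 'rV[R]_n -> R) (x : 'rV[R]_n) (l : 'I_q) :
  G l x <= 0 \/ H l x <= 0 ->
  [/\ G l x - ybar G H x 0 l <= 0, H l x - zbar G H x 0 l <= 0,
      0 <= ybar G H x 0 l, 0 <= zbar G H x 0 l &
      ybar G H x 0 l * zbar G H x 0 l = 0].
Proof.
rewrite !mxE !inE /=.
(* The alternative excludes the case of two positive values; each other case
   leaves an arithmetic check. *)
case: (ltgtP (G l x) 0) => Gx; case: (ltgtP (H l x) 0) => Hx //= GH;
  first [by case: GH | by split; lra].
Qed.

Lemma cc_mpoc_feasible_lift (R : realType) (n m p q : nat)
    (g : 'I_m -> 'rV[R]_n -> R) (h : 'I_p -> 'rV[R]_n -> R)
    (G H : 'I_q -> 'rV[R]_n -> R) (x : 'rV[R]_n) :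
  mpoc_feasible g h G H x ->
  cc_mpoc_feasible g h G H (x, ybar G H x, zbar G H x).
Proof.
by case=> gx hx GHx; split=> // l; exact: associated_constraints.
Qed.

(** Under a projection of feasible sets, every competitor upstairs has the
    same objective value as a competitor downstairs, so a minimizer downstairs
    stays one at any feasible point above it.  Continuity at that one point is
    all that the local version needs. *)
Lemma local_minimizer_lift (R : realType) (S T : topologicalType)
    (pi : S -> T) (f : T -> R) (X : set T) (Y : set S) (s : S) :
  {for s, continuous pi} -> (forall t, Y t -> X (pi t)) -> Y s ->
  local_minimizer f X (pi s) -> local_minimizer (f \o pi) Y s.
Proof.
move=> pi_cont YX Ys [_ fmin]; split=> //.
have near_s : \forall t \near s, X (pi t) -> f (pi s) <= f (pi t).
  exact: (pi_cont _ fmin).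
by near=> t => /YX; near: t.
Unshelve. all: by end_near.
Qed.

Lemma global_minimizer_lift (R : realType) (S T : Type)
    (pi : S -> T) (f : T -> R) (X : set T) (Y : set S) (s : S) :
  (forall t, Y t -> X (pi t)) -> Y s ->
  global_minimizer f X (pi s) -> global_minimizer (f \o pi) Y s.
Proof. by move=> YX Ys [_ fmin]; split=> // t /YX; exact: fmin. Qed.

(** Descending requires the projection to be onto, so that no competitor
    downstairs escapes the comparison upstairs. *)
Lemma global_minimizer_proj (R : realType) (S T : Type)
    (pi : S -> T) (f : T -> R) (X : set T) (Y : set S) (s : S) :
  (forall t, Y t -> X (pi t)) ->
  (forall x, X x -> exists2 t, Y t & pi t = x) ->
  global_minimizer (f \o pi) Y s -> global_minimizer f X (pi s).
Proof.
move=> YX XY [Ys fmin]; split=> [|x /XY[t Yt <-]]; first exact: YX.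
exact: fmin.
Qed.

Theorem proposition4p3 (R : realType) (n m p q : nat)
  (n_gt0 : (0 < n)%N) (m_gt0 : (0 < m)%N) (p_gt0 : (0 < p)%N) (q_gt0 : (0 < q)%N)
  (f : 'rV[R]_n -> R) (g : 'I_m -> 'rV[R]_n -> R) (h : 'I_p -> 'rV[R]_n -> R)
  (G H : 'I_q -> 'rV[R]_n -> R)
  (fC1 : continuously_differentiable f)
  (gC1 : forall i, continuously_differentiable (g i))
  (hC1 : forall j, continuously_differentiable (h j))
  (GC1 : forall l, continuously_differentiable (G l))
  (HC1 : forall l, continuously_differentiable (H l)) :
  (forall xbar : 'rV[R]_n, mpoc_feasible g h G H xbar ->
     (local_minimizer f (mpoc_feasible g h G H) xbar ->
      local_minimizer (cc_mpoc_objective f) (cc_mpoc_feasible g h G H)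
        (xbar, ybar G H xbar, zbar G H xbar)) /\
     (global_minimizer f (mpoc_feasible g h G H) xbar ->
      global_minimizer (cc_mpoc_objective f) (cc_mpoc_feasible g h G H)
        (xbar, ybar G H xbar, zbar G H xbar))) /\
  (forall (xt : 'rV[R]_n) (yt zt : 'rV[R]_q),
     global_minimizer (cc_mpoc_objective f) (cc_mpoc_feasible g h G H)
       (xt, yt, zt) ->
     global_minimizer f (mpoc_feasible g h G H) xt).
Proof.
have proj := @cc_mpoc_feasible_proj R n m p q g h G H.
pose pi (w : 'rV[R]_n * 'rV[R]_q * 'rV[R]_q) := w.1.1.
have pi_cont w : {for w, continuous pi}.
  by apply: continuous_comp; exact: cvg_fst.
split=> [x Xx | x y z].
  have Yx := cc_mpoc_feasible_lift Xx; split=> fmin.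
    exact: (local_minimizer_lift (pi_cont (x, _, _)) proj Yx fmin).
  exact: (global_minimizer_lift (pi := pi) proj Yx fmin).
apply: (global_minimizer_proj (pi := pi) (s := (x, y, z)) proj) => x' Xx'.
by exists (x', ybar G H x', zbar G H x'); first exact: cc_mpoc_feasible_lift.
Qed.
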